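(* Let $q$ be a prime power and let $n\ge 1$. The number of $F$-stable maximal tori of $GL_n(\overline{F_q})$ whose number of irreducible factors is $\equiv n \pmod 2$, minus the number of $F$-stable maximal tori of $GL_n(\overline{F_q})$ whose number of irreducible factors is $\not\equiv n \pmod 2$, is equal to $q^{(n^2-n)/2}$.
   Context: $F_q$ is the finite field with $q$ elements and $F$ denotes the Frobenius map on $GL_n(\overline{F_q})$ raising each matrix entry to the $q$-th power. A maximal torus $T$ is $F$-stable if $F(T)=T$. Each $F$-stable maximal torus $T$ has a type, a partition $\lambda$ of $n$: let $T_0$ be the diagonal torus and write $T=gT_0g^{-1}$ with $g\in GL_n(\overline{F_q})$; then $g^{-1}F(g)$ lies in the normalizer $N(T_0)$, its image in $N(T_0)/T_0\cong S_n$ is well defined up to conjugacy, and $\lambda$ is the cycle type of this conjugacy class. The number of irreducible factors of $T$ is the number of parts of $\lambda$. *)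

(* Defs.v *)
From HB Require Import structures.
From mathcomp Require Import all_boot all_order all_algebra all_fingroup.
From mathcomp Require Import boolp classical_sets functions cardinality.
From mathcomp Require mpoly.
Set Implicit Arguments.
Unset Strict Implicit.
Unset Printing Implicit Defensive.
Import GRing.Theory.
Local Open Scope classical_set_scope.
Local Open Scope ring_scope.

Definition algebraic_closure (F : fieldType) (K : closedFieldType)
    (iota : {rmorphism F -> K}) : Prop :=
  forall x : K, algebraicOver iota x.

Section LinearAlgebraicGroups.
Variable K : fieldType.

(* Subgroups of GL_n(K) are represented as sets of invertible matrices. *)
Definition GLset (n : nat) : set 'M[K]_n := [set g | g \in unitmx].
Arguments GLset : clear implicits.

(* The value of a polynomial in n * n variables at the entries of g. *)
Definition mx_eval (n : nat) (P : mpoly.mpoly (n * n)%N K) (g : 'M[K]_n) : K :=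
  mpoly.meval (fun k => mxvec g 0 k) P.

Definition GL_closed (n : nat) (A : set 'M[K]_n) : Prop :=
  exists S : set (mpoly.mpoly (n * n)%N K),
    A = [set g | GLset n g /\ forall P, S P -> mx_eval P g = 0].

Definition GL_subgroup (n : nat) (A : set 'M[K]_n) : Prop :=
  [/\ A `<=` GLset n, A 1%:M,
      forall g h, A g -> A h -> A (g *m h) &
      forall g, A g -> A (invmx g)].

Definition algebraic_group (n : nat) (A : set 'M[K]_n) : Prop :=
  GL_subgroup A /\ GL_closed A.

(* The coordinate ring of a closed subset of GL_n consists of the restrictions
   of the elements of K[x_11, ..., x_nn, 1 / det]. *)
Definition regular (n : nat) (A : set 'M[K]_n) (f : 'M[K]_n -> K) : Prop :=
  exists (P : mpoly.mpoly (n * n)%N K) (N : nat),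
    forall g, A g -> f g = mx_eval P g / \det g ^+ N.

Definition algebraic_morphism (m n : nat) (A : set 'M[K]_m) (B : set 'M[K]_n)
    (f : 'M[K]_m -> 'M[K]_n) : Prop :=
  [/\ forall g, A g -> B (f g),
      forall g h, A g -> A h -> f (g *m h) = f g *m f h &
      forall i j, regular A (fun g => f g i j)].

Definition algebraic_isomorphic (m n : nat)
    (A : set 'M[K]_m) (B : set 'M[K]_n) : Prop :=
  exists (f : 'M[K]_m -> 'M[K]_n) (f' : 'M[K]_n -> 'M[K]_m),
    [/\ algebraic_morphism A B f, algebraic_morphism B A f',
        forall g, A g -> f' (f g) = g & forall h, B h -> f (f' h) = h].

Definition diag_torus (n : nat) : set 'M[K]_n :=
  [set t | GLset n t /\ is_diag_mx t].
Arguments diag_torus : clear implicits.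

(* The diagonal torus of GL_d is the model of the d-fold power of the
   multiplicative group. *)
Definition torus (n : nat) (T : set 'M[K]_n) : Prop :=
  algebraic_group T /\ exists d : nat, algebraic_isomorphic (diag_torus d) T.

Definition maximal_torus (n : nat) (T : set 'M[K]_n) : Prop :=
  torus T /\ forall T' : set 'M[K]_n, torus T' -> T `<=` T' -> T' = T.

Definition conj_set (n : nat) (g : 'M[K]_n) (A : set 'M[K]_n) : set 'M[K]_n :=
  [set g *m t *m invmx g | t in A].

Definition Frob (q n : nat) (g : 'M[K]_n) : 'M[K]_n :=
  map_mx (fun x => x ^+ q) g.

Definition F_stable (q n : nat) (T : set 'M[K]_n) : Prop :=
  [set Frob q t | t in T] = T.

Definition cycle_type (n : nat) (w : 'S_n) : seq nat :=
  sort geq [seq #|C| | C : {set 'I_n} <- enum (porbits w)].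

(* The isomorphism between S_n and N(T_0) / T_0 sends w to the coset
   perm_mx w T_0. *)
Definition torus_type (q n : nat) (T : set 'M[K]_n) (lambda : seq nat) : Prop :=
  exists (g : 'M[K]_n) (w : 'S_n),
    [/\ GLset n g, T = conj_set g (diag_torus n),
        exists2 t, diag_torus n t & invmx g *m Frob q g = perm_mx w *m t &
        lambda = cycle_type w].

Definition irreducible_factors (q n : nat) (T : set 'M[K]_n) (r : nat) : Prop :=
  exists2 lambda, torus_type q T lambda & r = size lambda.

Definition F_stable_maximal_tori (q n : nat) : set (set 'M[K]_n) :=
  [set T | maximal_torus T /\ F_stable q T].

End LinearAlgebraicGroups.

Arguments F_stable_maximal_tori : clear implicits.

(* Main.v *)
Require Import Defs.
From HB Require Import structures.
From mathcomp Require Import all_boot all_order all_algebra all_fingroup all_field.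
From mathcomp Require Import boolp classical_sets functions cardinality.
From mathcomp Require mpoly.
Import (canonicals) mpoly.
Set Implicit Arguments.
Unset Strict Implicit.
Unset Printing Implicit Defensive.
Import GRing.Theory.
Local Open Scope classical_set_scope.
Local Open Scope card_scope.
Local Open Scope ring_scope.

(** Write [D] for the diagonal torus and [F] for the Frobenius map.

    Maximal tori.  Every element of [K] is algebraic over a finite field, so
    every element of a torus has finite order prime to the characteristic.  A
    torus is therefore a commuting family of diagonalizable matrices, hence is
    conjugate into [D], and the maximal tori are exactly the conjugates
    [g D g^-1] ([maximal_torusP]).

    Counting.  For a permutation [w], the vectors [y] with [F y = y w] form an
    [Fq]-space [V_w], which spans [K^n] ([twisted_fixed_basis]); it has [q^n]
    elements, and its basis is an invertible [g_w] with [F g_w = g_w w].  The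
    matrices [g] with [F g = g w] are the [h g_w] with [h] in [GL_n(Fq)].  Every
    F-stable maximal torus is [g D g^-1] for some such [w] and [g]
    ([torus_of_surj]); and, if [M_w] is the number of vectors of [V_w] without
    zero entry, each torus arises from [n! M_w] pairs [(w, h)], because [g] may be
    multiplied by a vector counted by [M_w] and by a permutation
    ([card_torus_of]).  The number of irreducible factors is congruent to [n]
    modulo 2 exactly when [w] is even.  Summing signs over all pairs, the wanted
    difference [d] satisfies [n! d = #|GL_n(Fq)| S_n] where [S_n] is the sum over
    [w] of [sgn w / M_w] ([sum_representatives]).

    The signed sum.  Sorting the [q^n] vectors of [V_w] by their support [J]
    gives [q^n / M_w = \sum_J 1 / M_(w, ~J)], over the [w]-stable sets [J], where
    [M_(w, ~J)] counts the vectors of support [~J] ([sum_nb_fixed],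
    [nb_fixed_ratio]).  Sum this over [w] with signs.  If [J] contains two indices,
    exchanging them changes the sign of [w] but not [M_(w, ~J)], so [J] contributes
    [0]; each singleton contributes [S_(n-1)], and the empty set contributes [S_n].
    Hence [(q^n - 1) S_n = n S_(n-1)] ([signed_sum_rec]), so
    [S_n = n! / \prod_(1 <= i <= n) (q^i - 1)].  As [#|GL_n(Fq)|] is the same
    product times [q^(n(n-1)/2)], the difference is [q^(n(n-1)/2)]. *)

(** * The Frobenius endomorphism of the algebraic closure *)

Section FrobeniusField.
Variables (Fq : finFieldType) (K : closedFieldType) (iota : {rmorphism Fq -> K}).

Lemma card_field_pchar : exists2 p : nat, p \in [pchar K] & exists n, #|Fq| = (p ^ n)%N.
Proof.
have [p p_pr pF] := finPcharP Fq.
exists p; first by rewrite (fmorph_pchar iota).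
by exists (logn p #|Fq|); exact: (card_pprimeChar pF).
Qed.

Lemma card_field_eq0 : #|Fq|%:R = 0 :> K.
Proof.
have [p pK [n qE]] := card_field_pchar.
case: n qE => [|n] qE; last by rewrite qE expnS natrM pcharf0 // mul0r.
by have := finNzRing_gt1 Fq; rewrite qE.
Qed.

Lemma frobenius_rmorphism : exists phi : {rmorphism K -> K}, forall x, phi x = x ^+ #|Fq|.
Proof.
have [p pK [n qE]] := card_field_pchar.
have p_pr := pcharf_prime pK.
have qnat : [pchar K].-nat #|Fq|.
  by rewrite (eq_pnat _ (pcharf_eq pK)) qE pnatX pnat_id.
pose f := fun x : K => x ^+ #|Fq|.
have fB : zmod_morphism f.
  by move=> x y; rewrite /f exprDn_pchar // exprNn_pchar.
have fM : monoid_morphism f.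
  by split=> [|x y]; rewrite /f ?expr1n ?exprMn.
pose fA := GRing.isZmodMorphism.Build _ _ f fB.
pose fR := GRing.isMonoidMorphism.Build _ _ f fM.
pose phi : GRing.RMorphism.type K K := HB.pack f fA fR.
by exists phi.
Qed.

(** The [#|Fq|] elements of [Fq] already exhaust the roots of [X^q - X]. *)
Lemma frobenius_fixed x : x ^+ #|Fq| = x -> exists a, x = iota a.
Proof.
move=> xq.
have : root (map_poly iota ('X^#|Fq| - 'X)) x.
  by rewrite rmorphB /= map_polyXn map_polyX /root !hornerE xq subrr.
rewrite finField_genPoly map_prod_XsubC -(big_map iota xpredT (fun a => 'X - a%:P)).
by rewrite root_prod_XsubC => /mapP[a _ ->]; exists a.
Qed.

(** The polynomial [c X^(q^N) - X] has derivative [-1], so it is separable and has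
    as many roots as its degree. *)
Lemma roots_twisted_frobenius (c : K) N : c != 0 -> (0 < N)%N ->
  exists rs : seq K, [/\ uniq rs, size rs = (#|Fq| ^ N)%N &
    forall x, x \in rs -> c * x ^+ (#|Fq| ^ N) = x].
Proof.
move=> c_neq0 N_gt0; have q_gt1 : (1 < #|Fq|)%N by exact: finNzRing_gt1.
set Q := (#|Fq| ^ N)%N.
have Q_gt1 : (1 < Q)%N by rewrite -(expn0 #|Fq|) ltn_exp2l.
have QK : Q%:R = 0 :> K.
  by rewrite /Q -(prednK N_gt0) expnS natrM card_field_eq0 mul0r.
pose P : {poly K} := c *: 'X^Q - 'X.
have sizeX : (size (- 'X : {poly K}) < size (c *: 'X^Q))%N.
  by rewrite size_polyN size_polyX size_scale // size_polyXn.
have sizeP : size P = Q.+1.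
  by rewrite /P size_polyDl // size_scale // size_polyXn.
have sepP : separable_poly P.
  rewrite unlock /P derivB derivZ derivXn derivX -mulr_natr.
  rewrite -polyC_natr QK polyC0 mulr0 scaler0 sub0r -(scaleN1r 1).
  by rewrite coprimepZr ?oppr_eq0 ?oner_eq0 // coprimep1.
have [rs rsE] := closed_field_poly_normal P.
have P_neq0 : lead_coef P != 0 by rewrite lead_coef_eq0 -size_poly_eq0 sizeP.
exists rs; split.
- by move: sepP; rewrite rsE (eqp_separable (eqp_scale _ _)) // separable_prod_XsubC.
- by apply: succn_inj; rewrite -sizeP [in RHS]rsE size_scale // size_prod_XsubC.
move=> x; rewrite -root_prod_XsubC -(rootZ _ _ P_neq0) -rsE /root !hornerE.
by rewrite subr_eq0 => /eqP.
Qed.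

Hypothesis hK : algebraic_closure iota.

(** The Frobenius orbit of [x] stays among the finitely many roots of a polynomial
    over [Fq] that kills [x]; since Frobenius is injective, the orbit is purely
    periodic. *)
Lemma frobenius_periodic (x : K) : exists2 N, (0 < N)%N & x ^+ (#|Fq| ^ N) = x.
Proof.
have [phi phiE] := frobenius_rmorphism.
have iterE N y : iter N phi y = y ^+ (#|Fq| ^ N).
  by elim: N => [|N IH]; rewrite ?expr1 //= IH phiE -exprM -expnSr.
have [p p_neq0 px] := hK x.
have root_iter N : root (map_poly iota p) (iter N phi x).
  elim: N => //= N IH; move: IH.
  rewrite /root -(fmorph_eq0 phi) -horner_map -map_poly_comp.
  rewrite (_ : map_poly (phi \o iota) p = map_poly iota p) //.
  by apply: eq_map_poly => a /=; rewrite phiE -rmorphXn expf_card.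
set s := mkseq (fun N => iter N phi x) (size p).+1.
have /(uniqPn 0)[i [j []]] : ~~ uniq s.
  apply/negP => s_uniq.
  have p'_neq0 : map_poly iota p != 0 by rewrite map_poly_eq0.
  have := max_poly_roots p'_neq0 _ s_uniq.
  rewrite size_map_poly size_mkseq ltnNge leqnSn => /(_ _)/negP[] //.
  by apply/allP => _ /mapP[N _ ->].
rewrite size_mkseq => i_lt_j j_lt; have i_lt := ltn_trans i_lt_j j_lt.
rewrite !nth_mkseq // => ijE.
exists (j - i)%N; first by rewrite subn_gt0.
(* Cancelling the first [i] steps makes the period start at [x] itself. *)
have iter_inj N : injective (iter N phi).
  by elim: N => //= N IH y z /fmorph_inj/IH.
by apply: (iter_inj i); rewrite -iterE -iterD subnKC // ltnW.
Qed.


End FrobeniusField.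

(** * Fixed vectors of monomial semilinear maps *)

(** Finite-dimensionality in matrix form: a set of row vectors, however large, is
    spanned by finitely many of its members. *)
Lemma exists_spanning_rows (F : fieldType) n (S : 'rV[F]_n -> Prop) :
  exists m (A : 'M[F]_(m, n)),
    (forall i, S (row i A)) /\ forall y, S y -> (y <= A)%MS.
Proof.
apply: contrapT => noA.
suff grow r : exists m (A : 'M[F]_(m, n)), (forall i, S (row i A)) /\ (r <= \rank A)%N.
  by have [m [A [_]]] := grow n.+1; rewrite leqNgt ltnS rank_leq_col.
elim: r => [|r [m [A [A_S rkA]]]]; first by exists 0%N, 0; split=> // -[].
have [y [yS yA]] : exists y, S y /\ ~~ (y <= A)%MS.
  apply: contrapT => noy; apply: noA; exists m, A; split=> // y yS.
  by apply/negPn/negP => yA; apply: noy; exists y.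
exists (m + 1)%N, (col_mx A y); split.
  move=> i; case: (split_ordP i) => i' ->; rewrite ?rowKu //.
  by rewrite rowKd ord1 row_id.
apply: leq_ltn_trans rkA _; apply: rank_ltmx.
by rewrite ltmxE col_mx_sub submx_refl /= -addsmxE addsmxSl.
Qed.

Section TwistedFixedVectors.
Variables (Fq : finFieldType) (K : closedFieldType) (iota : {rmorphism Fq -> K}).
Variables (phi : {rmorphism K -> K}) (phiE : forall x, phi x = x ^+ #|Fq|).

Definition supp n (y : 'rV[K]_n) : {set 'I_n} := [set i | y 0 i != 0].

Section Monomial.
Variables (n : nat) (c : 'I_n -> K) (u : 'S_n).
Hypothesis c_neq0 : forall j, c j != 0.

(** The fixed vectors of a Frobenius-semilinear map with monomial matrix.  The
    case [c = 1] describes the twisted form of affine space attached to a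
    permutation; general [c] is needed to bring [g^-1 F(g)] to a permutation
    matrix. *)
Definition twisted_fixed (y : 'rV[K]_n) := forall j, y 0 (u j) = c j * phi (y 0 j).

(** This is Lang's theorem for a monomial matrix.  Starting from [a e_i], the
    semilinear map moves along the cycle of [i], and after [N = #[u]] steps
    multiplies by [C_N] and raises [a] to the power [q^N]; if [a] is a root of
    [C_N X^(q^N) - X], the sum of the [N] iterates is fixed.  A linear form [z]
    that kills all these sums gives a polynomial in [a] of degree less than [q^N]
    with [q^N] roots, and its coefficient of degree [1] is [z i]. *)
Lemma twisted_fixed_span (z : 'cV[K]_n) :
  (forall y, twisted_fixed y -> y *m z = 0) -> z = 0.
Proof.
move=> yz0; apply/colP => i; rewrite mxE.
have q_gt1 : (1 < #|Fq|)%N by exact: finNzRing_gt1.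
pose N := #[u]%g; have N_gt0 : (0 < N)%N by exact: order_gt0.
(* The [k]-th iterate of [a e_i] is [C k * a ^ (q ^ k)] times a basis vector. *)
pose C := fix C k := if k is k'.+1 then c ((u ^+ k')%g i) * phi (C k') else 1.
have C_neq0 k : C k != 0.
  by elim: k => [|k IH] /=; rewrite ?oner_eq0 // mulf_neq0 ?fmorph_eq0.
pose X a k := C k * a ^+ (#|Fq| ^ k).
have XS a k : c ((u ^+ k)%g i) * phi (X a k) = X a k.+1.
  by rewrite /X rmorphM rmorphXn (phiE a) -exprM -expnS mulrA.
have [rs [rs_uniq rs_size rs_root]] :=
  roots_twisted_frobenius iota (C_neq0 N) N_gt0.
pose Q : {poly K} := \sum_(k < N) (C k * z ((u ^+ k)%g i) 0) *: 'X^(#|Fq| ^ k).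
have Q_root a : a \in rs -> root Q a.
  move=> /rs_root XN; rewrite /root.
  pose y : 'rV[K]_n := \row_j \sum_(k < N) X a k *+ ((u ^+ k)%g i == j).
  have y_fix : twisted_fixed y.
    move=> j; rewrite !mxE rmorph_sum mulr_sumr.
    rewrite [RHS](eq_bigr (fun k : 'I_N => X a k.+1 *+ ((u ^+ k.+1)%g i == u j))); last first.
      move=> k _; rewrite expgSr permM (inj_eq (@perm_inj _ u)).
      case: eqP => [jE|_]; last by rewrite mulr0n rmorph0 mulr0.
      by rewrite -jE !mulr1n XS.
    rewrite -(prednK N_gt0) big_ord_recl [RHS]big_ord_recr /= addrC.
    congr (_ + _); rewrite prednK //.
    by rewrite expg_order /X XN /= expn0 mul1r.
  move/(congr1 (fun M : 'M_1 => M 0 0)): (yz0 y y_fix); rewrite !mxE => <-.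
  apply/eqP; rewrite horner_sum.
  under [RHS]eq_bigr => j _ do rewrite mxE mulr_suml.
  rewrite exchange_big; apply: eq_bigr => k _ /=.
  rewrite (bigD1 ((u ^+ k)%g i)) //= eqxx big1 ?addr0 => [|j /negPf jN].
    by rewrite !hornerE mulrAC.
  by rewrite eq_sym jN mul0r.
have Q0 : Q = 0.
  apply/eqP/negPn/negP => Q_neq0.
  have := max_poly_roots Q_neq0 _ rs_uniq.
  move=> /(_ _)/wrap[]; first by apply/allP => a /Q_root.
  rewrite ltnNge rs_size; apply/negP/negPn.
  apply: leq_trans (size_sum _ _ _) _; apply/bigmax_leqP => k _.
  apply: leq_trans (size_scale_leq _ _) _.
  by rewrite size_polyXn ltn_exp2l.
move/(congr1 (fun P : {poly K} => P`_1)): Q0.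
rewrite coef0 coef_sum -(prednK N_gt0) big_ord_recl /= big1 => [|k _].
  by rewrite coefZ expn0 coefXn eqxx mul1r mulr1 addr0 perm1.
rewrite coefZ coefXn.
by rewrite -[X in X == _](expn0 #|Fq|) (inj_eq (expnI q_gt1)) mulr0.
Qed.

(** The support of a fixed vector is stable under [u], so two fixed vectors can be
    glued along a support.  Fixed vectors have no common zero coordinate because
    they span, so the support can be enlarged until it is everything. *)
Lemma twisted_fixed_full : exists2 y, twisted_fixed y & supp y = [set: 'I_n]%SET.
Proof.
suff [y y_fix] : exists2 y, twisted_fixed y & (n <= #|supp y|)%N.
  by exists y => //; apply/eqP; rewrite eqEcard finset.subsetT cardsT card_ord.
suff grow m : (m <= n)%N -> exists2 y, twisted_fixed y & (m <= #|supp y|)%N.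
  exact: grow.
elim: m => [|m IH] m_le.
  by exists 0 => // j; rewrite !mxE rmorph0 mulr0.
have [y y_fix y_supp] := IH (ltnW m_le).
have [/eqP yT|] := boolP (supp y == [set: 'I_n]%SET).
  by exists y; rewrite // yT cardsT card_ord.
rewrite finset.eqEsubset finset.subsetT /= => /subsetPn[j _ jNy].
have [y' y'_fix y'j] : exists2 y', twisted_fixed y' & y' 0 j != 0.
  apply: contrapT => noy.
  have /colP/(_ j)/eqP : delta_mx j 0 = 0 :> 'cV[K]_n.
    apply: twisted_fixed_span => y' y'_fix; apply/colP => k.
    rewrite -colE !mxE ord1.
    by apply/eqP/negPn/negP => y'j; apply: noy; exists y'.
  by rewrite !mxE !eqxx oner_eq0.
exists (\row_k if y 0 k != 0 then y 0 k else y' 0 k).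
  move=> k; rewrite !mxE y_fix mulf_eq0 fmorph_eq0 (negPf (c_neq0 k)) /=.
  by case: ifP => _; rewrite ?y'_fix.
apply: leq_trans (_ : #|j |: supp y| <= _)%N; first by rewrite cardsU1 jNy.
apply: subset_leq_card; apply/fintype.subsetP => k; rewrite !inE mxE.
case/orP => [/eqP->|yk]; last by rewrite yk.
by move: jNy; rewrite inE => /negPf->.
Qed.

Lemma twisted_fixed_basis :
  exists2 g : 'M[K]_n, g \in unitmx & forall i, twisted_fixed (row i g).
Proof.
have [m [A [A_fix A_span]]] := exists_spanning_rows twisted_fixed.
(* A nonzero column of the cokernel would be a linear form killing all fixed vectors. *)
have fA : row_full A.
  rewrite -cokermx_eq0; apply/eqP/matrixP => i k; rewrite [RHS]mxE.
  suff /colP/(_ i) : col k (cokermx A) = 0 by rewrite !mxE.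
  apply: twisted_fixed_span => y /A_span/submxP[D ->].
  by rewrite colE -mulmxA (mulmxA A) mulmx_coker mul0mx mulmx0.
exists (rowsub (fullrankfun fA) A); first exact: fullrowsub_unit.
by move=> i; rewrite row_rowsub; apply: A_fix.
Qed.

End Monomial.
End TwistedFixedVectors.

(** * Conjugates of the diagonal torus *)

Lemma invmx_mul (R : comUnitRingType) n (g h : 'M[R]_n) :
  g \in unitmx -> h \in unitmx -> invmx (g *m h) = invmx h *m invmx g.
Proof.
move=> gU hU; have ghU : g *m h \in unitmx by rewrite unitmx_mul gU.
by apply: (can_inj (mulKmx ghU)); rewrite mulmxV // !mulmxA mulmxK // mulmxV.
Qed.

Section Conjugation.
Variables (K : fieldType) (n : nat).
Local Notation D := (@diag_torus K n).
Implicit Types g h x : 'M[K]_n.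

Lemma mem_diag_torus (s : 'rV[K]_n) : D (diag_mx s) <-> forall i, s 0 i != 0.
Proof.
rewrite /diag_torus /GLset /= diag_mx_is_diag unitmxE det_diag unitfE prodf_seq_neq0.
split=> [[/allP s0 _] i|s0]; first by apply: (s0 i); rewrite mem_index_enum.
by split=> //; apply/allP => i _; rewrite s0.
Qed.

Lemma diag_torusP x : D x -> exists2 s : 'rV[K]_n, x = diag_mx s & forall i, s 0 i != 0.
Proof.
by move=> Dx; case: (Dx) => _ /diag_mxP[s xE]; exists s => //; apply/mem_diag_torus; rewrite -xE.
Qed.

Lemma conj_setE g (A : set 'M[K]_n) x : g \in unitmx ->
  conj_set g A x <-> A (invmx g *m x *m g).
Proof.
move=> gU; split=> [[t At <-]|Ax]; first by rewrite !mulmxA mulVmx // mul1mx mulmxKV.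
by exists (invmx g *m x *m g); rewrite // !mulmxA mulmxV // mul1mx mulmxK.
Qed.

Lemma conj_setM g h (A : set 'M[K]_n) : g \in unitmx -> h \in unitmx ->
  conj_set (g *m h) A = conj_set g (conj_set h A).
Proof.
move=> gU hU; apply/seteqP.
split=> x; by rewrite !conj_setE ?unitmx_mul ?gU ?hU // invmx_mul // !mulmxA.
Qed.

Lemma conj_set_inj g (A B : set 'M[K]_n) : g \in unitmx ->
  conj_set g A = conj_set g B -> A = B.
Proof.
move=> gU AB; apply/seteqP; split=> x Ax.
  suff : conj_set g B (g *m x *m invmx g).
    by rewrite conj_setE // !mulmxA mulVmx // mul1mx mulmxKV.
  by rewrite -AB; exists x.
suff : conj_set g A (g *m x *m invmx g).
  by rewrite conj_setE // !mulmxA mulVmx // mul1mx mulmxKV.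
by rewrite AB; exists x.
Qed.

(** Entries of [a x b] are linear in the entries of [x]; this supplies both the
    equations of a conjugate of the diagonal torus and the regularity of
    conjugation. *)
Lemma linear_entry_poly (a b : 'M[K]_n) i j :
  exists P, forall x, mx_eval P x = (a *m x *m b) i j.
Proof.
exists (\sum_k \sum_l (a i l * b k j) *: mpoly.mpolyX K (mpoly.mnm1 (mxvec_index l k))).
move=> x; rewrite /mx_eval.
rewrite (big_morph _ (mpoly.mevalD _) (mpoly.meval0 _)) mxE.
apply: eq_bigr => k _; rewrite mxE mulr_suml.
rewrite (big_morph _ (mpoly.mevalD _) (mpoly.meval0 _)).
apply: eq_bigr => l _.
by rewrite mpoly.mevalZ mpoly.mevalXU mxvecE mulrAC.
Qed.

Lemma conj_morphism g (A B : set 'M[K]_n) : g \in unitmx ->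
  (forall x, A x -> B (g *m x *m invmx g)) ->
  algebraic_morphism A B (fun x => g *m x *m invmx g).
Proof.
move=> gU AB; split=> // [x y _ _|i j].
  by rewrite !mulmxA mulmxKV.
have [P PE] := linear_entry_poly g (invmx g) i j.
by exists P, 0%N => x _; rewrite PE expr0 divr1.
Qed.

(** The equations are the vanishing of the off-diagonal entries of [g^-1 x g]. *)
Lemma conj_diag_torus_torus g : g \in unitmx -> torus (conj_set g D).
Proof.
move=> gU; have gVU : invmx g \in unitmx by rewrite unitmx_inv.
have conjM x y : invmx g *m (x *m y) *m g = (invmx g *m x *m g) *m (invmx g *m y *m g).
  by rewrite !mulmxA mulmxK.
have conjU x : invmx g *m x *m g \in unitmx -> x \in unitmx.
  by rewrite !unitmx_mul gU gVU andbT.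
have memD x y : D x -> D y -> D (x *m y).
  move=> /diag_torusP[s -> s0] /diag_torusP[t -> t0].
  by rewrite mulmx_diag mem_diag_torus => i; rewrite mxE mulf_neq0.
have memDV x : D x -> D (invmx x).
  move=> /diag_torusP[s -> s0].
  suff -> : invmx (diag_mx s) = diag_mx (\row_i (s 0 i)^-1).
    by rewrite mem_diag_torus => i; rewrite mxE invr_neq0.
  have sU : diag_mx s \in unitmx by case/mem_diag_torus: s0.
  apply: (can_inj (mulKmx sU)); rewrite mulmxV // mulmx_diag -diag_const_mx.
  by congr diag_mx; apply/rowP => i; rewrite !mxE divff.
split; last first.
  exists n, (fun x => g *m x *m invmx g), (fun x => invmx g *m x *m g); split.
  - by apply: conj_morphism => // x Dx; exists x.
  - have := @conj_morphism (invmx g) (conj_set g D) D gVU; rewrite invmxK; apply.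
    by move=> x; rewrite conj_setE.
  - by move=> x _; rewrite !mulmxA mulVmx // mul1mx mulmxKV.
  by move=> x _; rewrite !mulmxA mulmxV // mul1mx mulmxK.
split; last first.
  pose S := [set P : mpoly.mpoly (n * n) K | exists i j : 'I_n, i != j /\
    forall x, mx_eval P x = (invmx g *m x *m g) i j].
  exists S; apply/seteqP; split=> x /=.
    rewrite conj_setE // => -[xU /is_diag_mxP xD]; split; first exact: conjU.
    by move=> P [i [j [ij ->]]]; exact: xD.
  case=> xU PS; rewrite conj_setE //; split; first by rewrite /GLset /= !unitmx_mul gU gVU xU.
  apply/is_diag_mxP => i j ij; have [P PE] := linear_entry_poly (invmx g) g i j.
  by rewrite -PE; apply: PS; exists i, j.
split.
- by move=> x; rewrite conj_setE // => -[xU _]; exact: conjU.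
- rewrite conj_setE // mulmx1 mulVmx // -diag_const_mx mem_diag_torus => i.
  by rewrite mxE oner_neq0.
- by move=> x y; rewrite !conj_setE // conjM; exact: memD.
move=> x; rewrite !conj_setE // => /[dup][[/conjU xU _]] /memDV.
by rewrite !invmx_mul ?invmxK ?unitmx_mul ?gVU ?xU // mulmxA.
Qed.

End Conjugation.

(** * Monomial matrices and the normalizer of the diagonal torus *)

Section Monomial.
Variables (K : fieldType) (n : nat).
Local Notation D := (@diag_torus K n).
Implicit Types (s t : 'rV[K]_n) (v w : 'S_n).

Lemma monomialE s v i j : (diag_mx s *m perm_mx v) i j = s 0 i *+ (v i == j).
Proof. by rewrite mul_diag_mx !mxE mulr_natr. Qed.

Lemma perm_mx_diag v s :
  perm_mx v *m diag_mx s = diag_mx (\row_i s 0 (v i)) *m perm_mx v.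
Proof.
by apply/matrixP => i j; rewrite monomialE -row_permE !mxE; case: eqP => // <-.
Qed.

Lemma monomial_unit s v : (forall i, s 0 i != 0) -> diag_mx s *m perm_mx v \in unitmx.
Proof. by move=> s0; rewrite unitmx_mul unitmx_perm andbT; case/mem_diag_torus: s0. Qed.

Lemma monomial_inj s v t w : (forall i, s 0 i != 0) ->
  diag_mx s *m perm_mx v = diag_mx t *m perm_mx w -> s = t /\ v = w.
Proof.
move=> s0 /matrixP st.
have vw : v = w.
  apply/permP => i; apply/eqP; move: (st i (v i)); rewrite !monomialE eqxx mulr1n eq_sym.
  by case: eqP => // _ /eqP; rewrite (negPf (s0 i)).
split=> //; apply/rowP => i; move: (st i (v i)).
by rewrite !monomialE -vw eqxx !mulr1n.
Qed.

Lemma conj_setP (g : 'M[K]_n) (A : set 'M[K]_n) x : g \in unitmx ->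
  conj_set g A x <-> exists2 t, A t & x *m g = g *m t.
Proof.
move=> gU; split=> [[t At <-]|[t At xg]]; exists t => //; first by rewrite mulmxKV.
by rewrite -xg mulmxK.
Qed.

Lemma monomial_diag s v t : diag_mx s *m perm_mx v *m diag_mx t =
  diag_mx (\row_i t 0 (v i)) *m (diag_mx s *m perm_mx v).
Proof.
rewrite -mulmxA perm_mx_diag !mulmxA !mulmx_diag; congr (diag_mx _ *m _).
by apply/rowP => i; rewrite !mxE mulrC.
Qed.

Lemma conj_monomial s v : (forall i, s 0 i != 0) ->
  conj_set (diag_mx s *m perm_mx v) D = D.
Proof.
move=> s0; have xU := monomial_unit v s0.
apply/seteqP; split=> x.
  rewrite conj_setP // => -[_ /diag_torusP[t -> t0]].
  rewrite monomial_diag => /(can_inj (mulmxK xU)) ->.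
  by apply/mem_diag_torus => i; rewrite mxE.
move=> /diag_torusP[t -> t0]; rewrite conj_setP //.
exists (diag_mx (\row_i t 0 ((v^-1)%g i))).
  by apply/mem_diag_torus => i; rewrite mxE.
rewrite monomial_diag; congr (diag_mx _ *m _).
by apply/rowP => i; rewrite !mxE permK.
Qed.

Section Regular.
Variables (r : 'rV[K]_n) (r0 : forall i, r 0 i != 0) (r_inj : injective (r 0)).

(** A diagonal matrix with distinct entries has only diagonal matrices in its
    centralizer. *)
Lemma commute_regular x : x *m diag_mx r = diag_mx r *m x -> is_diag_mx x.
Proof.
move=> /matrixP xr; apply/is_diag_mxP => i j ij.
move: (xr i j); rewrite mul_diag_mx mul_mx_diag !mxE => /eqP.
rewrite mulrC -subr_eq0 -mulrBl mulf_eq0 subr_eq0 => /orP[|/eqP //].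
by move=> /eqP/r_inj/esym ji; rewrite ji eqxx in ij.
Qed.

(** If [t x = x r] with [t] diagonal and [r] diagonal with distinct entries, a
    nonzero entry [x i j] forces [t i = r j], so each row of [x] has only one
    nonzero entry; invertibility makes its position injective. *)
Lemma normalizer_diag_torus x : x \in unitmx -> conj_set x D = D ->
  exists s v, (forall i, s 0 i != 0) /\ x = diag_mx s *m perm_mx v.
Proof.
move=> xU xD.
(* Here [t'] is the diagonal matrix [x r x^-1]. *)
have [t' tE] : exists t, diag_mx t *m x = x *m diag_mx r.
  have : conj_set x D (x *m diag_mx r *m invmx x).
    by exists (diag_mx r) => //; apply/mem_diag_torus.
  by rewrite xD => /diag_torusP[t tE _]; exists t; rewrite -tE mulmxKV.
have xE i j : x i j != 0 -> t' 0 i = r 0 j.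
  move=> xij; move/matrixP/(_ i j): tE; rewrite mul_diag_mx mul_mx_diag !mxE.
  by rewrite mulrC => /(mulfI xij).
have row_neq0 i : exists j, x i j != 0.
  apply: contrapT => noj; move: (mulmxV xU) => /matrixP/(_ i i)/eqP.
  rewrite !mxE eqxx big1 ?(eq_sym 0) ?oner_eq0 // => j _.
  have [->|xij] := eqVneq (x i j) 0; first by rewrite mul0r.
  by case: noj; exists j.
have [f fE] := choice row_neq0.
have x0 i j : f i != j -> x i j = 0.
  move=> fij; apply/eqP/negPn/negP => /xE; rewrite (xE _ _ (fE i)).
  by move/r_inj/eqP; apply/negP.
have f_inj : injective f.
  move=> i i' fii'; apply/eqP/negPn/negP => ii'.
  have prodE a b : (x *m invmx x) a b = x a (f a) * invmx x (f a) b.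
    by rewrite mxE (bigD1 (f a)) //= big1 ?addr0 // => j; rewrite eq_sym => /x0->; rewrite mul0r.
  have /eqP := prodE i i'; rewrite mulmxV // mxE (negPf ii') eq_sym mulf_eq0.
  rewrite (negPf (fE i)) /= fii' => /eqP y0.
  have /eqP := prodE i' i'; rewrite y0 mulr0 mulmxV // mxE eqxx.
  by rewrite oner_eq0.
exists (\row_i x i (f i)), (perm f_inj); split=> [i|]; first by rewrite mxE.
apply/matrixP => i j; rewrite monomialE mxE permE.
by case: eqP => [<-|/eqP/x0 ->].
Qed.

End Regular.
End Monomial.

(** * Maximal tori *)

Section MaximalTori.
Variables (Fq : finFieldType) (K : closedFieldType) (iota : {rmorphism Fq -> K}).

(** Field elements of the desired kind are found among the roots of
    [X^(q^(n+1)) - X], which are distinct and more numerous than [n + 1]. *)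
Lemma exists_regular n : exists2 r : 'rV[K]_n, forall i, r 0 i != 0 & injective (r 0).
Proof.
have [rs [rs_uniq rs_size _]] := roots_twisted_frobenius iota (oner_neq0 K) (ltn0Sn n).
(* Only [0] has to be discarded among the roots. *)
pose rs' := rem 0 rs.
have rs'_size : (n < size rs')%N.
  apply: leq_trans (_ : (size rs).-1 <= _)%N; last first.
    by rewrite /rs'; have [/size_rem->//|/rem_id->] := boolP (0 \in rs); exact: leq_pred.
  rewrite rs_size -ltnS prednK ?expn_gt0 ?(ltnW (finNzRing_gt1 Fq)) //.
  by rewrite ltn_expl // finNzRing_gt1.
have lt_size (i : 'I_n) : (i < size rs')%N by exact: ltn_trans rs'_size.
exists (\row_i rs'`_i) => [i|i j]; rewrite !mxE.
  by have := mem_nth 0 (lt_size i); rewrite mem_rem_uniq // inE => /andP[].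
by move/eqP; rewrite nth_uniq ?rem_uniq // => /eqP/val_inj.
Qed.

Hypothesis hK : algebraic_closure iota.

(** The exponent [M = q^N - 1], with [N] a common period of the entries under
    Frobenius, is prime to the characteristic. *)
Lemma diag_periodic d (s : 'rV[K]_d) : (forall i, s 0 i != 0) ->
  exists2 M, M%:R != 0 :> K & forall i, s 0 i ^+ M = 1.
Proof.
move=> s0; have q_gt1 := finNzRing_gt1 Fq.
have /choice[f fP] i : exists N, (0 < N)%N /\ s 0 i ^+ (#|Fq| ^ N) = s 0 i.
  by have [N] := frobenius_periodic hK (s 0 i); exists N.
pose N := (\prod_i f i)%N.
have N_gt0 : (0 < N)%N by apply: prodn_gt0 => i; case: (fP i).
have Q_gt0 : (0 < #|Fq| ^ N)%N by rewrite expn_gt0 ltnW.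
exists (#|Fq| ^ N).-1.
  suff -> : (#|Fq| ^ N).-1%:R = - 1 :> K by rewrite oppr_eq0 oner_eq0.
  rewrite -subn1 natrB // natrX (card_field_eq0 iota) expr0n.
  by rewrite eqn0Ngt N_gt0 sub0r.
move=> i; apply: (mulIf (s0 i)); rewrite mul1r -exprSr prednK //.
have -> : N = (f i * \prod_(j | j != i) f j)%N by rewrite /N (bigD1 i).
rewrite expnM; elim: (\prod_(j | j != i) f j)%N => [|m IH].
  by rewrite expn0 expr1.
by rewrite expnS exprM; case: (fP i) => _ ->.
Qed.

Section Torus.
Variables (m : nat) (T : set 'M[K]_m.+1) (T_torus : torus T).

Lemma torus_comm x y : T x -> T y -> x *m y = y *m x.
Proof.
move: T_torus => [_ [d [f [f' [[fT fM _] [f'D _ _] _ f'K]]]]] Tx Ty.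
rewrite -(f'K _ Tx) -(f'K _ Ty) -!fM; try exact: f'D.
have [/diag_torusP[s -> _] /diag_torusP[t -> _]] := (f'D _ Tx, f'D _ Ty).
by rewrite !mulmx_diag; congr (f (diag_mx _)); apply/rowP => i; rewrite !mxE mulrC.
Qed.

(** The property holds in the diagonal model of the torus, and an isomorphism
    carries it over because it respects products. *)
Lemma torus_finite_order x : T x -> exists2 M, M%:R != 0 :> K & x ^+ M = 1.
Proof.
move: T_torus => [[[T_GL _ _ _] _] [d [f [f' [[fT fM _] [f'D _ _] _ f'K]]]]] Tx.
have /diag_torusP[s sE s0] := f'D _ Tx.
have [M M0 sM] := diag_periodic s0; exists M => //.
have fX k : f (diag_mx (\row_i s 0 i ^+ k)) = x ^+ k.
  elim: k => [|k IH].
    set e := diag_mx _.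
    have De : diag_torus e by apply/mem_diag_torus => i; rewrite mxE expr0 oner_neq0.
    apply: (can_inj (mulKmx (T_GL _ (fT _ De)))).
    rewrite -fM // mulmx1 mulmx_diag; congr (f (diag_mx _)).
    by apply/rowP => i; rewrite !mxE mulr1.
  rewrite exprS -mulmxE -IH -{1}(f'K _ Tx) sE -fM; first last.
  - by apply/mem_diag_torus => i; rewrite mxE expf_neq0.
  - by rewrite -sE; exact: f'D.
  by rewrite mulmx_diag; congr (f (diag_mx _)); apply/rowP => i; rewrite !mxE exprS.
rewrite -(fX M) -(expr0 x) -(fX 0%N); congr (f (diag_mx _)).
by apply/rowP => i; rewrite !mxE sM expr0.
Qed.

(** The minimal polynomial divides [X^M - 1], which is separable. *)
Lemma finite_order_diagonalizable (x : 'M[K]_m.+1) M : M%:R != 0 :> K -> x ^+ M = 1 ->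
  exists2 P, P \in unitmx & similar_diag P x.
Proof.
move=> M0 xM; apply/diagonalizableP.
have [rs rsE] := closed_field_poly_normal ('X^M - 1 : {poly K}).
have M_gt0 : (0 < M)%N by case: M M0 {xM rsE}; rewrite ?eqxx.
move: rsE; rewrite (eqP (monicXnsubC 1 M_gt0)) scale1r => rsE.
exists rs; first by rewrite -separable_prod_XsubC -rsE; exact: separable_Xn_sub_1.
by rewrite -rsE; apply: mxminpoly_min; rewrite rmorphB rmorph1 /= rmorphXn /= horner_mx_X xM subrr.
Qed.

(** Finitely many elements span the torus linearly; these commute and are
    diagonalizable, and a basis that diagonalizes them diagonalizes the torus. *)
Lemma torus_sub_conj_diag :
  exists2 g, g \in unitmx & T `<=` conj_set g (@diag_torus K m.+1).
Proof.
pose S y := T (vec_mx y); have [N [A [AS A_span]]] := exists_spanning_rows S.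
have [|P PU /allP/= PA] :=
    (codiagonalizableP [seq vec_mx (row i A) | i <- enum 'I_N]).1.
  split=> [_ _ /mapP[i _ ->] /mapP[j _ ->]|_ /mapP[i _ ->]].
    by apply: torus_comm; exact: AS.
  by have [M M0 xM] := torus_finite_order (AS i); exact: finite_order_diagonalizable M0 xM.
exists (invmx P) => [|x Tx]; first by rewrite unitmx_inv.
rewrite conj_setE ?unitmx_inv // invmxK; split.
  rewrite /GLset /= !unitmx_mul unitmx_inv PU !andbT.
  by move: T_torus => [[[T_GL _ _ _] _] _]; exact: T_GL.
have /A_span/submxP[C xC] : S (mxvec x) by rewrite /S mxvecK.
have -> : x = \sum_i C 0 i *: vec_mx (row i A).
  rewrite -[LHS]mxvecK xC mulmx_sum_row linear_sum.
  by apply: eq_bigr => i _; rewrite linearZ.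
apply/is_diag_mxP => i j ij; rewrite mulmx_sumr mulmx_suml summxE big1 // => k _.
rewrite -scalemxAr -scalemxAl mxE.
have /PA kP : vec_mx (row k A) \in [seq vec_mx (row i A) | i <- enum 'I_N].
  by apply/mapP; exists k => //; rewrite mem_enum.
by rewrite (similar_diagP _ PU kP) ?mulr0.
Qed.

End Torus.

(** A torus containing a conjugate of the diagonal torus commutes with a conjugate
    of a matrix with distinct diagonal entries, hence is contained in that
    conjugate. *)
Lemma maximal_torusP m (T : set 'M[K]_m.+1) :
  maximal_torus T <-> exists2 g, g \in unitmx & T = conj_set g (@diag_torus K m.+1).
Proof.
split=> [[T_torus T_max]|[g gU ->]].
  have [g gU Tg] := torus_sub_conj_diag T_torus.
  by exists g => //; apply/esym/T_max => //; exact: conj_diag_torus_torus.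
split=> [|T' T'_torus gT']; first exact: conj_diag_torus_torus.
apply/seteqP; split=> // x T'x; rewrite conj_setE //.
have [r r0 r_inj] := exists_regular m.+1.
have xU : x \in unitmx by move: T'_torus => [[[T_GL _ _ _] _] _]; exact: T_GL.
split; first by rewrite /GLset /= !unitmx_mul unitmx_inv gU xU.
apply: (commute_regular r_inj).
have Tr : T' (g *m diag_mx r *m invmx g).
  by apply: gT'; exists (diag_mx r) => //; apply/mem_diag_torus.
have := torus_comm T'_torus T'x Tr.
move/(congr1 (fun y => invmx g *m y *m g)).
by rewrite !mulmxA mulmxKV // mulVmx // mul1mx.
Qed.

End MaximalTori.

(** * Counting fixed vectors of twisted permutation maps by support *)

Lemma leq_card_param (U U' : finType) (X : Type) (e : U -> X) (e' : U' -> X)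
    (A : {set U}) (A' : {set U'}) :
  {in A &, injective e} ->
  (forall a, a \in A -> exists2 a', a' \in A' & e a = e' a') -> (#|A| <= #|A'|)%N.
Proof.
move=> e_inj eA.
have /choice[f fP] a : exists o : option U',
    a \in A -> exists a', [/\ o = Some a', a' \in A' & e a = e' a'].
  have [aA|_] := boolP (a \in A); last by exists None.
  by have [a' a'A ea] := eA a aA; exists (Some a') => _; exists a'.
rewrite -(card_imset (mem A') (@Some_inj _)) -(card_in_imset (f := f)).
  apply/subset_leq_card/fintype.subsetP => _ /imsetP[a aA ->].
  by have [a' [-> a'A _]] := fP a aA; apply: imset_f.
move=> a b aA bA fab; apply: e_inj => //.
have [a' [fa _ ->]] := fP a aA; have [b' [fb _ ->]] := fP b bA.
by move: fab; rewrite fa fb => -[->].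
Qed.

(** Two finite sets that parametrize injectively the same subset of a (possibly
    infinite) type have equal cardinals; this is how finite sets are compared
    through vectors and matrices over [K]. *)
Lemma eq_card_param (U U' : finType) (X : Type) (e : U -> X) (e' : U' -> X)
    (A : {set U}) (A' : {set U'}) :
  {in A &, injective e} -> {in A' &, injective e'} ->
  (forall a, a \in A -> exists2 a', a' \in A' & e a = e' a') ->
  (forall a', a' \in A' -> exists2 a, a \in A & e' a' = e a) -> #|A| = #|A'|.
Proof.
move=> e_inj e'_inj eA e'A; apply/eqP.
by rewrite eqn_leq (leq_card_param e_inj eA) (leq_card_param e'_inj e'A).
Qed.

Section FixedVectors.
Variables (Fq : finFieldType) (K : closedFieldType) (iota : {rmorphism Fq -> K}).
Variables (phi : {rmorphism K -> K}) (phiE : forall x, phi x = x ^+ #|Fq|).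

Lemma frobenius_descent m n (A : 'M[K]_(m, n)) :
  map_mx phi A = A -> exists B, A = map_mx iota B.
Proof.
move=> /matrixP phiA.
have /choice[B BE] (ij : 'I_m * 'I_n) : exists a, A ij.1 ij.2 = iota a.
  by apply: frobenius_fixed; rewrite -phiE -[RHS]phiA mxE.
by exists (\matrix_(i, j) B (i, j)); apply/matrixP => i j; rewrite !mxE -BE.
Qed.

Lemma frobenius_iota m n (B : 'M[Fq]_(m, n)) :
  map_mx phi (map_mx iota B) = map_mx iota B.
Proof. by apply/matrixP => i j; rewrite !mxE phiE -rmorphXn expf_card. Qed.

Lemma lang_perm n (w : 'S_n) :
  exists g : 'M[K]_n, g \in unitmx /\ map_mx phi g = g *m perm_mx w.
Proof.
have [g gU g_fix] := twisted_fixed_basis iota phiE w^-1 (fun=> oner_neq0 K).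
exists g; split=> //; apply/matrixP => i j; rewrite -[w]invgK -col_permE.
by have := g_fix i j; rewrite !mxE mul1r => <-.
Qed.

(** Only existence is known for these matrices, so one is chosen for each [w].  It
    gives [Fq]-coordinates on the fixed vectors. *)
Definition lang_mx n (w : 'S_n) : 'M[K]_n := projT1 (cid (lang_perm w)).

Lemma lang_mx_unit n (w : 'S_n) : lang_mx w \in unitmx.
Proof. by rewrite /lang_mx; case: cid => g []. Qed.

Lemma lang_mxE n (w : 'S_n) : map_mx phi (lang_mx w) = lang_mx w *m perm_mx w.
Proof. by rewrite /lang_mx; case: cid => g []. Qed.

Definition perm_fixed n (w : 'S_n) (y : 'rV[K]_n) := forall i, phi (y 0 (w i)) = y 0 i.

(** The coordinates of the fixed vectors of [w] in the basis of rows of [lang_mx w].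
    The definition is locked so that entries are not expanded as a matrix
    product. *)
Definition fixed_vec n (w : 'S_n) (u : 'rV[Fq]_n) : 'rV[K]_n :=
  locked (map_mx iota u *m lang_mx w).

Lemma fixed_vecE n (w : 'S_n) u : fixed_vec w u = map_mx iota u *m lang_mx w.
Proof. by rewrite /fixed_vec -lock. Qed.

Lemma fixed_vec_inj n (w : 'S_n) : injective (fixed_vec w).
Proof. by move=> u v; rewrite !fixed_vecE => /(can_inj (mulmxK (lang_mx_unit w)))/map_mx_inj. Qed.

Lemma fixed_vecP n (w : 'S_n) (y : 'rV[K]_n) :
  perm_fixed w y <-> exists u, y = fixed_vec w u.
Proof.
have -> : perm_fixed w y <-> map_mx phi y = y *m perm_mx w.
  split=> [y_fix|/rowP yE i].
    apply/rowP => j; rewrite -[w]invgK -col_permE !mxE -[in RHS]y_fix.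
    by rewrite permKV.
  by have := yE (w i); rewrite -{2}[w]invgK -col_permE !mxE => ->; rewrite permK.
split=> [yE|[u ->]]; last by rewrite fixed_vecE map_mxM frobenius_iota lang_mxE mulmxA.
have [|u uE] := @frobenius_descent 1 n (y *m invmx (lang_mx w)).
  rewrite map_mxM yE map_invmx lang_mxE.
  rewrite invmx_mul ?lang_mx_unit ?unitmx_perm // mulmxA mulmxK //.
  by rewrite unitmx_perm.
by exists u; rewrite fixed_vecE -uE mulmxKV // lang_mx_unit.
Qed.

Lemma perm_fixed_supp n (w : 'S_n) (y : 'rV[K]_n) i :
  perm_fixed w y -> (w i \in supp y) = (i \in supp y).
Proof. by move=> y_fix; rewrite !inE -(y_fix i) fmorph_eq0. Qed.

(** For [J] the whole index set this is the order of the group of rational points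
    of a torus of type [w]. *)
Definition nb_fixed n (w : 'S_n) (J : {set 'I_n}) : nat :=
  #|[set u | supp (fixed_vec w u) == J]%SET|.

Lemma sum_nb_fixed n (w : 'S_n) : (\sum_J nb_fixed w J = #|Fq| ^ n)%N.
Proof.
rewrite -[n in (_ ^ n)%N]mul1n -card_mx -sum1_card.
rewrite (partition_big (fun u => supp (fixed_vec w u)) xpredT) //=.
by apply: eq_bigr => J _; rewrite sum1dep_card; apply: eq_card => u; rewrite !inE.
Qed.

Lemma nb_fixed_stable n (w : 'S_n) J i : nb_fixed w J != 0 -> (w i \in J) = (i \in J).
Proof.
rewrite -lt0n => /card_gt0P[u]; rewrite inE => /eqP<-.
by apply: perm_fixed_supp; apply/fixed_vecP; exists u.
Qed.

(** Counts for different permutations, or in different dimensions, are compared on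
    the fixed vectors themselves, because their coordinates depend on the chosen
    matrices [lang_mx]. *)
Lemma nb_fixed_eq n n' (w : 'S_n) (w' : 'S_n') J J' X (e : 'rV[K]_n -> X) (e' : 'rV[K]_n' -> X) :
  injective e -> injective e' ->
  (forall y, perm_fixed w y -> supp y = J ->
    exists y', [/\ perm_fixed w' y', supp y' = J' & e y = e' y']) ->
  (forall y', perm_fixed w' y' -> supp y' = J' ->
    exists y, [/\ perm_fixed w y, supp y = J & e' y' = e y]) ->
  nb_fixed w J = nb_fixed w' J'.
Proof.
move=> e_inj e'_inj ee' e'e.
apply: (@eq_card_param _ _ _ (e \o fixed_vec w) (e' \o fixed_vec w')).
- by move=> u v _ _ /e_inj/fixed_vec_inj.
- by move=> u v _ _ /e'_inj/fixed_vec_inj.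
- move=> u; rewrite inE => /eqP uJ.
  have [|y' [/fixed_vecP[u' ->] u'J uu']] := ee' _ _ uJ; first by apply/fixed_vecP; exists u.
  by exists u' => //; rewrite inE u'J.
move=> u; rewrite inE => /eqP uJ.
have [|y' [/fixed_vecP[u' ->] u'J uu']] := e'e _ _ uJ; first by apply/fixed_vecP; exists u.
by exists u' => //; rewrite inE u'J.
Qed.

(** The constant vector [1] is fixed by every permutation. *)
Lemma nb_fixed_full_neq0 n (w : 'S_n) : nb_fixed w [set: 'I_n]%SET != 0.
Proof.
have /fixed_vecP[u uE] : perm_fixed w (const_mx 1) by move=> i; rewrite !mxE rmorph1.
rewrite -lt0n; apply/card_gt0P; exists u; rewrite inE -uE.
by apply/eqP/setP => i; rewrite !inE mxE oner_eq0.
Qed.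

(** A fixed vector without zero entry is the sum of its restrictions to [J] and to
    the complement, and these are fixed because [J] is stable. *)
Lemma nb_fixedM n (w : 'S_n) (J : {set 'I_n}) : (forall i, (w i \in J) = (i \in J)) ->
  (nb_fixed w J * nb_fixed w (~: J) = nb_fixed w [set: 'I_n]%SET)%N.
Proof.
move=> wJ; rewrite -cardsX.
apply: (@eq_card_param _ _ _ (fun u => fixed_vec w u.1 + fixed_vec w u.2) (fixed_vec w)).
- have supp0 u (J' : {set 'I_n}) i :
      supp (fixed_vec w u) == J' -> i \notin J' -> fixed_vec w u 0 i = 0.
    by move=> /eqP<-; rewrite inE negbK => /eqP.
  move=> [u1 u2] [v1 v2]; rewrite !inE /= => /andP[u1J u2J] /andP[v1J v2J] /rowP uv.
  congr pair; apply: (@fixed_vec_inj _ w); apply/rowP => i; move: (uv i); rewrite !mxE.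
    have [iJ|iJ] := boolP (i \in J); last by rewrite (supp0 _ _ i u1J) // (supp0 _ _ i v1J).
    by rewrite (supp0 _ _ i u2J) ?(supp0 _ _ i v2J) ?inE ?iJ // !addr0.
  have [iJ|iJ] := boolP (i \in J); last first.
    by rewrite (supp0 _ _ i u1J) ?(supp0 _ _ i v1J) // !add0r.
  by rewrite (supp0 _ _ i u2J) ?(supp0 _ _ i v2J) ?inE ?iJ.
- by move=> u v _ _ /fixed_vec_inj.
- move=> [u1 u2]; rewrite !inE /= => /andP[/eqP u1J /eqP u2J].
  have /fixed_vecP[u uE] : perm_fixed w (fixed_vec w u1 + fixed_vec w u2).
    move=> i; rewrite !mxE rmorphD.
    by congr (_ + _); move: i; apply/fixed_vecP; [exists u1|exists u2].
  exists u => //; rewrite inE -uE; apply/eqP/setP => i; rewrite !inE mxE.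
  move/setP/(_ i): u1J; move/setP/(_ i): u2J; rewrite !inE.
  by case: (i \in J) => /= [/negbFE/eqP->|]; [rewrite addr0|move=> ? /negbFE/eqP->; rewrite add0r].
move=> u; rewrite inE => /eqP/setP uT.
have u_fix : perm_fixed w (fixed_vec w u) by apply/fixed_vecP; exists u.
(* Restriction of the given vector to a stable set of indices. *)
have mask (J' : {set 'I_n}) : (forall i, (w i \in J') = (i \in J')) ->
    exists2 u', supp (fixed_vec w u') = J' &
      fixed_vec w u' = \row_i (fixed_vec w u 0 i *+ (i \in J')).
  move=> wJ'; have /fixed_vecP[u' u'E] : perm_fixed w (\row_i (fixed_vec w u 0 i *+ (i \in J'))).
    by move=> i; rewrite !mxE wJ' rmorphMn u_fix.
  exists u' => //; apply/setP => i; rewrite -u'E !inE mxE.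
  by case: (i \in J'); rewrite ?eqxx //; move: (uT i); rewrite !inE.
have [u1 u1J u1E] := mask J wJ.
have [|u2 u2J u2E] := mask (~: J); first by move=> i; rewrite !inE wJ.
exists (u1, u2); first by rewrite !inE /= u1J u2J !eqxx.
rewrite u1E u2E; apply/rowP => i; rewrite !mxE !inE.
by case: (i \in J); rewrite ?addr0 ?add0r.
Qed.

End FixedVectors.

(** * The signed sum over the symmetric group *)

Section SignedCount.
Variables (Fq : finFieldType) (K : closedFieldType) (iota : {rmorphism Fq -> K}).
Variables (phi : {rmorphism K -> K}) (phiE : forall x, phi x = x ^+ #|Fq|).

Local Notation nb := (nb_fixed iota phiE).

(** Up to the factor [n!], the signed average over the symmetric group of the
    inverse orders of the twisted diagonal tori. *)
Definition signed_sum n : rat :=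
  \sum_(w : 'S_n) (-1) ^+ w / (nb w [set: 'I_n]%SET)%:R.

(** When [J] is not stable both sides are zero: no fixed vector has support [J] or
    its complement, and the inverse of [0] is [0]. *)
Lemma nb_fixed_ratio n (w : 'S_n) (J : {set 'I_n}) :
  (nb w J)%:R / (nb w [set: 'I_n]%SET)%:R = ((nb w (~: J))%:R)^-1 :> rat.
Proof.
have MT := nb_fixed_full_neq0 iota phiE w.
have [J0|J_neq0] := eqVneq (nb w J) 0%N.
  have [->|/nb_fixed_stable JC] := eqVneq (nb w (~: J)) 0%N; first by rewrite J0 mul0r invr0.
  have wJ i : (w i \in J) = (i \in J).
    by have := JC i; rewrite !inE => /negb_inj.
  by move: MT; rewrite -(nb_fixedM iota phiE wJ) J0 mul0n.
have wJ i : (w i \in J) = (i \in J) by exact: nb_fixed_stable J_neq0.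
rewrite -(nb_fixedM iota phiE wJ) natrM invfM mulrA divff ?mul1r //.
by rewrite Num.Theory.pnatr_eq0.
Qed.

(** Composing [w] with a transposition inside [J] only affects coordinates in the
    stable set [J], where [y] vanishes. *)
Lemma perm_fixed_tperm n (w : 'S_n) (J : {set 'I_n}) i j (y : 'rV[K]_n) :
  i \in J -> j \in J -> supp y = ~: J -> perm_fixed phi w y -> perm_fixed phi (tperm i j * w)%g y.
Proof.
move=> iJ jJ yJ y_fix k; rewrite permM.
have y0 l : l \in J -> y 0 (w l) = 0 /\ y 0 l = 0.
  move=> lJ; have lNy : l \notin supp y by rewrite yJ inE lJ.
  have := lNy; rewrite -(perm_fixed_supp l y_fix); move: lNy.
  by rewrite !inE !negbK => /eqP-> /eqP->.
have [[ywi yi] [ywj yj]] := (y0 i iJ, y0 j jJ).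
by case: tpermP => [->|->|_ _]; rewrite ?ywi ?ywj ?yi ?yj ?rmorph0 // y_fix.
Qed.

Lemma nb_fixed_tperm n (w : 'S_n) (J : {set 'I_n}) i j : i \in J -> j \in J ->
  nb (tperm i j * w)%g (~: J) = nb w (~: J).
Proof.
move=> iJ jJ; apply: (@nb_fixed_eq _ _ _ _ _ _ _ _ _ _ _ _ id id) => // y y_fix yJ;
  exists y; split=> //.
  by rewrite -[w]mul1g -(tperm2 i j) -mulgA; exact: (perm_fixed_tperm iJ jJ yJ).
exact: (perm_fixed_tperm iJ jJ yJ).
Qed.

(** Multiplication of [w] by a transposition of two elements of [J] is a
    sign-reversing involution that preserves the counts. *)
Lemma signed_sum_cancel n (J : {set 'I_n}) : (1 < #|J|)%N ->
  \sum_(w : 'S_n) (-1) ^+ w / (nb w (~: J))%:R = 0 :> rat.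
Proof.
move=> /card_gt1P[i [j [iJ jJ ij]]]; set S := \sum_w _.
have : S = - S.
  rewrite {1}/S (reindex_inj (mulgI (tperm i j))) -sumrN; apply: eq_bigr => w _.
  by rewrite nb_fixed_tperm // odd_permM odd_tperm ij signr_addb expr1 mulN1r mulNr.
by move/eqP; rewrite -subr_eq0 opprK -mulr2n Num.Theory.mulrn_eq0 => /eqP.
Qed.

Lemma lift_perm_surj n (j : 'I_n.+1) (w : 'S_n.+1) : w j = j ->
  exists w', w = lift_perm j j w'.
Proof.
move=> wj.
have /choice[f fE] (k : 'I_n) : exists l, w (lift j k) = lift j l.
  have /unlift_some[l -> _] : j != w (lift j k).
    by rewrite -{1}wj (inj_eq perm_inj) neq_lift.
  by exists l.
have f_inj : injective f.
  by move=> k l fkl; apply: (@lift_inj _ j); apply: (@perm_inj _ w); rewrite !fE fkl.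
exists (perm f_inj); apply/permP => i.
case: (unliftP j i) => [k ->|->]; last by rewrite lift_perm_id.
by rewrite lift_perm_lift permE.
Qed.

Definition extend0 n (j : 'I_n.+1) (y : 'rV[K]_n) : 'rV[K]_n.+1 :=
  \row_i oapp (y 0) 0 (unlift j i).

Lemma nb_fixed_lift_perm n (j : 'I_n.+1) (w : 'S_n) :
  nb (lift_perm j j w) (~: [set j]%SET) = nb w [set: 'I_n]%SET.
Proof.
have liftNj k : (lift j k == j) = false by rewrite eq_sym (negPf (neq_lift _ _)).
have ext_j y : extend0 j y 0 j = 0 by rewrite mxE unlift_none.
have ext_lift y k : extend0 j y 0 (lift j k) = y 0 k by rewrite mxE liftK.
apply: (@nb_fixed_eq _ _ _ _ _ _ _ _ _ _ _ _ id (extend0 j)) => //.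
- by move=> y z /rowP yz; apply/rowP => k; have := yz (lift j k); rewrite !ext_lift.
- move=> y y_fix /setP yJ; exists (\row_k y 0 (lift j k)); split.
  + by move=> k; rewrite !mxE -[in RHS]y_fix lift_perm_lift.
  + by apply/setP => k; have := yJ (lift j k); rewrite !inE mxE liftNj.
  apply/rowP => i; case: (unliftP j i) => [k ->|->]; first by rewrite ext_lift mxE.
  by have := yJ j; rewrite !inE eqxx ext_j => /negbFE/eqP.
move=> y y_fix /setP yT; exists (extend0 j y); split=> //.
  move=> i; case: (unliftP j i) => [k ->|->]; first by rewrite lift_perm_lift !ext_lift.
  by rewrite lift_perm_id ext_j rmorph0.
apply/setP => i; case: (unliftP j i) => [k ->|->].
  by have := yT k; rewrite !inE ext_lift liftNj.
by rewrite !inE ext_j !eqxx.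
Qed.

(** Only the permutations fixing [j] contribute, and these are the permutations of
    the other indices. *)
Lemma signed_sum_set1 n (j : 'I_n.+1) :
  \sum_(w : 'S_n.+1) (-1) ^+ w / (nb w (~: [set j]%SET))%:R = signed_sum n.
Proof.
rewrite (bigID (fun w : 'S_n.+1 => w j == j)) /= [X in _ + X]big1 => [|w wj]; last first.
  have [->|nb0] := eqVneq (nb w (~: [set j]%SET)) 0%N.
    by rewrite invr0 mulr0.
  by have := nb_fixed_stable j nb0; rewrite !inE eqxx (negPf wj).
have lift_perm_inj : injective (lift_perm j j).
  move=> v w /permP vw; apply/permP => k.
  by apply: (@lift_inj _ j); rewrite -!(lift_perm_lift j) vw.
rewrite addr0 (eq_bigl (mem [set lift_perm j j w | w in [set: 'S_n]]%SET)).
  rewrite big_imset => [|v w _ _ /lift_perm_inj //].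
  apply: eq_big => [w|w _]; rewrite ?inE // nb_fixed_lift_perm odd_lift_perm.
  by rewrite addbb.
move=> w; apply/eqP/imsetP => [/lift_perm_surj[w' ->]|[w' _ ->]].
  by exists w'; rewrite ?inE.
exact: lift_perm_id.
Qed.

(** Expand [q^n.+1] as the number of all fixed vectors, sorted by support [J].  The
    empty [J] gives [signed_sum n.+1], the singletons give [n.+1] copies of
    [signed_sum n], and larger [J] cancel. *)
Lemma signed_sum_rec n :
  (#|Fq| ^ n.+1 - 1)%N%:R * signed_sum n.+1 = n.+1%:R * signed_sum n.
Proof.
rewrite natrB ?expn_gt0 ?(ltnW (finNzRing_gt1 Fq)) // mulrBl mul1r.
apply/eqP; rewrite subr_eq; apply/eqP.
transitivity (\sum_(J : {set 'I_n.+1}) \sum_(w : 'S_n.+1) (-1) ^+ w / (nb w (~: J))%:R : rat).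
  rewrite exchange_big mulr_sumr; apply: eq_bigr => w _ /=.
  rewrite -(sum_nb_fixed iota phiE w) natr_sum mulr_suml; apply: eq_bigr => J _.
  by rewrite mulrCA nb_fixed_ratio.
rewrite (bigD1 finset.set0) //= finset.setC0 addrC; congr (_ + _).
rewrite (bigID (fun J : {set _} => #|J| == 1%N)) /= [X in _ + X]big1 ?addr0 => [|J /andP[J0 J1]].
  rewrite (eq_bigr (fun=> signed_sum n)) => [|J /andP[_ /cards1P[j ->]]]; last first.
    exact: signed_sum_set1.
  rewrite sumr_const mulr_natl; congr (_ *+ _).
  transitivity #|[set J : {set 'I_n.+1} | #|J| == 1%N]%SET|.
    apply: eq_card => J; rewrite inE unfold_in.
    by have [->|] := eqVneq J finset.set0; rewrite ?cards0.
  by rewrite card_draws card_ord bin1.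
by apply: signed_sum_cancel; rewrite ltn_neqAle eq_sym J1 card_gt0.
Qed.

Lemma signed_sumE n : signed_sum n * (\prod_(1 <= i < n.+1) (#|Fq| ^ i - 1))%N%:R = n`!%:R.
Proof.
elim: n => [|n IH].
  rewrite big_geq // mulr1 /signed_sum (bigD1 1%g) //= big1 => [|w]; last first.
    by move/eqP; case; apply/permP => -[].
  suff -> : nb 1%g [set: 'I_0]%SET = 1%N by rewrite odd_perm1 addr0 divr1.
  apply/eqP; rewrite eqn_leq lt0n nb_fixed_full_neq0 andbT.
  have := sum_nb_fixed iota phiE (1%g : 'S_0); rewrite expn0 => <-.
  by rewrite (bigD1 [set: 'I_0]%SET) //= leq_addr.
rewrite big_nat_recr //= mulnC natrM mulrA [_ * (_ - 1)%N%:R]mulrC signed_sum_rec.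
by rewrite -mulrA IH -natrM factS.
Qed.

End SignedCount.

(** * Parametrization of the F-stable maximal tori *)

(** Links the two notions of cardinality: the tori form a set in an infinite type,
    their parameters a finite type. *)
Lemma card_image_finset (U : finType) (X : Type) (e : U -> X) (A : {set U}) :
  {in A &, injective e} -> [set x | exists2 u, u \in A & x = e u] #= `I_#|A|.
Proof.
move=> e_inj; have [A0|[u0 _]] := set_0Vmem A.
  have -> : [set x | exists2 u, u \in A & x = e u] = set0.
    by apply/seteqP; split=> // x [u]; rewrite A0 inE.
  by rewrite A0 cards0 II0; exact: card_eq00.
have size_A : size (enum A) = #|A| by rewrite cardE.
pose f k := e (nth u0 (enum A) k).
have -> : [set x | exists2 u, u \in A & x = e u] = [set f k | k in `I_#|A|].
  apply/seteqP; split=> [x [u uA ->]|_ [k /= kA <-]].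
    exists (index u (enum A)); first by rewrite /= -size_A index_mem mem_enum.
    by rewrite /f nth_index ?mem_enum.
  by exists (nth u0 (enum A) k) => //; rewrite -mem_enum mem_nth // size_A.
apply: inj_card_eq => k l; rewrite !inE /= => kA lA.
have mem_A i : (i < #|A|)%N -> nth u0 (enum A) i \in A.
  by move=> iA; rewrite -mem_enum mem_nth // size_A.
move=> /(e_inj _ _ (mem_A k kA) (mem_A l lA))/eqP.
by rewrite nth_uniq ?size_A ?enum_uniq // => /eqP.
Qed.

Section StableTori.
Variables (Fq : finFieldType) (K : closedFieldType) (iota : {rmorphism Fq -> K}).
Hypothesis hK : algebraic_closure iota.
Variables (phi : {rmorphism K -> K}) (phiE : forall x, phi x = x ^+ #|Fq|).
Variable m : nat.

Local Notation n := m.+1.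
Local Notation D := (@diag_torus K n).
Local Notation P := ('S_n * {'GL_n[Fq]})%type.
Local Notation nb := (nb_fixed iota phiE).
Implicit Types (p : P) (g h : 'M[K]_n) (w : 'S_n).

(** The matrices [g] with [F g = g w] for a permutation [w] (which [g] determines),
    encoded by the finitely many pairs [(w, h)] with [h] invertible over [Fq]; the
    columns of [g] span the lines of [K^n] stable under the torus.  Locked to
    prevent unfolding during rewriting with products. *)
Definition frame p : 'M[K]_n :=
  locked (map_mx iota (GLval p.2) *m lang_mx iota phiE p.1).

Lemma frameE p : frame p = map_mx iota (GLval p.2) *m lang_mx iota phiE p.1.
Proof. by rewrite /frame -lock. Qed.

Lemma frame_unit p : frame p \in unitmx.
Proof. by rewrite frameE unitmx_mul map_unitmx lang_mx_unit andbT; exact (GL_unitmx p.2). Qed.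

Lemma frob_frame p : map_mx phi (frame p) = frame p *m perm_mx p.1.
Proof. by rewrite frameE map_mxM (frobenius_iota _ phiE) lang_mxE mulmxA. Qed.

(** If [F g = g w] then [g g_w^-1] is fixed by Frobenius, hence has entries in
    [Fq]. *)
Lemma frame_surj g w : g \in unitmx -> map_mx phi g = g *m perm_mx w ->
  exists h : {'GL_n[Fq]}, g = frame (w, h).
Proof.
move=> gU gE; have lU := lang_mx_unit iota phiE w.
have [|h hE] := @frobenius_descent _ _ iota _ phiE _ _ (g *m invmx (lang_mx iota phiE w)).
  rewrite map_mxM gE map_invmx lang_mxE.
  by rewrite invmx_mul ?unitmx_perm // mulmxA mulmxK // unitmx_perm.
have hU : h \is a GRing.unit.
  by rewrite -[_ \is a _]/(h \in unitmx) -(map_unitmx iota) -hE unitmx_mul gU unitmx_inv.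
pose h' : {'GL_n[Fq]} := Sub h hU; have h'E : GLval h' = h by exact: SubK.
by exists h'; rewrite frameE h'E -hE mulmxKV.
Qed.

Lemma perm_mx_inj : injective (@perm_mx K n).
Proof.
move=> v w vw; have := @monomial_inj K n (const_mx 1) v (const_mx 1) w.
by rewrite vw => -[] // i; rewrite mxE oner_neq0.
Qed.

Lemma frame_inj : injective frame.
Proof.
move=> p p' pp'; have w_eq : p.1 = p'.1.
  apply: perm_mx_inj; apply: (can_inj (mulKmx (frame_unit p))).
  by rewrite -frob_frame pp' frob_frame.
move: pp'; rewrite !frameE.
case: p p' w_eq => [w h] [w' h'] /= -> /(can_inj (mulmxK (lang_mx_unit _ _ _))).
by move=> /map_mx_inj hh'; congr pair; exact: val_inj.
Qed.

Definition torus_of p : set 'M[K]_n := conj_set (frame p) D.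

Lemma conj_diag_perm w : conj_set (perm_mx w) D = D.
Proof.
rewrite -[perm_mx w]mul1mx -diag_const_mx; apply: conj_monomial => i.
by rewrite mxE oner_neq0.
Qed.

Lemma frobE g : Frob #|Fq| g = map_mx phi g.
Proof. by apply/matrixP => i j; rewrite !mxE phiE. Qed.

(** Frobenius is onto [K] because all its orbits are periodic. *)
Lemma frob_surj (x : K) : exists y, phi y = x.
Proof.
have [N N_gt0 xN] := frobenius_periodic hK x.
by exists (x ^+ (#|Fq| ^ N.-1)); rewrite phiE -exprM -expnSr prednK.
Qed.

Lemma frob_conj_diag g : g \in unitmx ->
  [set Frob #|Fq| t | t in conj_set g D] = conj_set (map_mx phi g) D.
Proof.
move=> gU; apply/seteqP; split=> [_ [_ [t Dt <-] <-]|_ [t Dt <-]].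
  exists (map_mx phi t); last by rewrite frobE !map_mxM map_invmx.
  move: Dt => /diag_torusP[s -> s0]; rewrite map_diag_mx; apply/mem_diag_torus => i.
  by rewrite mxE fmorph_eq0.
move: Dt => /diag_torusP[s -> s0]; have [f fE] := choice (fun i => frob_surj (s 0 i)).
exists (g *m diag_mx (\row_i f i) *m invmx g).
  exists (diag_mx (\row_i f i)) => //; apply/mem_diag_torus => i.
  by rewrite mxE -(fmorph_eq0 phi) fE.
rewrite frobE !map_mxM map_invmx map_diag_mx; congr (_ *m diag_mx _ *m _).
by apply/rowP => i; rewrite !mxE fE.
Qed.

Lemma torus_of_stable p : F_stable_maximal_tori K #|Fq| n (torus_of p).
Proof.
split; first by apply/(maximal_torusP hK); exists (frame p) => //; exact: frame_unit.
rewrite /F_stable frob_conj_diag ?frame_unit // frob_frame.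
by rewrite conj_setM ?frame_unit ?unitmx_perm // conj_diag_perm.
Qed.

(** The set of [g] that conjugate [D] to a given torus is a coset of the
    normalizer of [D]. *)
Lemma conj_diag_eq g h : g \in unitmx -> h \in unitmx ->
  conj_set g D = conj_set h D ->
  exists (s : 'rV[K]_n) (v : 'S_n), (forall i, s 0 i != 0) /\ h = g *m (diag_mx s *m perm_mx v).
Proof.
move=> gU hU gh; have [r r0 r_inj] := exists_regular iota n.
have gVh : invmx g *m h \in unitmx by rewrite unitmx_mul unitmx_inv gU.
have [|s [v [s0 sv]]] := normalizer_diag_torus r0 r_inj gVh.
  by apply: (conj_set_inj gU); rewrite -conj_setM // mulKVmx.
by exists s, v; split=> //; rewrite -sv mulKVmx.
Qed.

(** If [g D g^-1] is F-stable then [g^-1 F(g)] normalizes [D], so is a monomial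
    matrix [s v].  Lang's theorem for the torus, in the form of a fixed vector
    without zero entry, gives a diagonal [y] such that [F(g y) = (g y) v]. *)
Lemma torus_of_surj (T : set 'M[K]_n) : F_stable_maximal_tori K #|Fq| n T ->
  exists p, T = torus_of p.
Proof.
move=> [/(maximal_torusP hK)[g gU ->]]; rewrite /F_stable frob_conj_diag // => gF.
have FgU : map_mx phi g \in unitmx by rewrite map_unitmx.
have [s [v [s0 gE]]] := conj_diag_eq gU FgU (esym gF).
(* Solves [s_i phi(y_(v i)) = y_i], which says [s v F(y) = y v]. *)
have [y y_fix /setP y_full] := twisted_fixed_full iota phiE v^-1
  (c := fun j => s 0 ((v^-1)%g j)) (fun j => s0 _).
have y0 i : y 0 i != 0 by have := y_full i; rewrite !inE.
have yU : diag_mx y \in unitmx by case/mem_diag_torus: y0.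
have gyU : g *m diag_mx y \in unitmx by rewrite unitmx_mul gU.
have gyF : map_mx phi (g *m diag_mx y) = g *m diag_mx y *m perm_mx v.
  rewrite map_mxM gE map_diag_mx -!mulmxA perm_mx_diag; congr (g *m _).
  rewrite mulmxA mulmx_diag; congr (diag_mx _ *m _); apply/rowP => i; rewrite !mxE.
  by have := y_fix (v i); rewrite permK.
have [h hE] := frame_surj gyU gyF.
exists (v, h); rewrite /torus_of -hE conj_setM //; congr (conj_set g _).
have := conj_monomial 1 y0; rewrite perm_mx1 mulmx1; exact.
Qed.

(** The frames of a given torus differ from [frame p] by a monomial matrix [y v], and
    [F (g y v)] is again [g y v] times a permutation exactly when [y] is a fixed
    vector of [w = p.1]; the new permutation is then [v^-1 w v]. *)
Lemma card_torus_of p :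
  #|[set p' : P | `[< torus_of p' = torus_of p >]]%SET| = (n`! * nb p.1 [set: 'I_n]%SET)%N.
Proof.
set A := [set u | supp (fixed_vec iota phiE p.1 u) == [set: 'I_n]%SET]%SET.
rewrite -card_Sn -cardsT -[nb _ _]/(#|A|) -cardsX; apply/esym.
pose e (vu : 'S_n * 'rV[Fq]_n) :=
  frame p *m (diag_mx (fixed_vec iota phiE p.1 vu.2) *m perm_mx vu.1).
have full u i : supp (fixed_vec iota phiE p.1 u) == [set: 'I_n]%SET ->
    fixed_vec iota phiE p.1 u 0 i != 0.
  by move=> /eqP/setP uT; have := uT i; rewrite !inE.
apply: (@eq_card_param _ _ _ e frame).
- move=> [v u] [v' u']; rewrite !inE /= => uT _; have u0 i := full u i uT.
  by move=> /(can_inj (mulKmx (frame_unit p)))/(monomial_inj u0)[/fixed_vec_inj /= -> ->].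
- by move=> p1 p2 _ _ /frame_inj.
- move=> [v u]; rewrite !inE /= => uT; have u0 i := full u i uT.
  have u_fix : perm_fixed phi p.1 (fixed_vec iota phiE p.1 u).
    by apply/(fixed_vecP iota phiE); exists u.
  have eU : e (v, u) \in unitmx by rewrite /e unitmx_mul frame_unit monomial_unit.
  have eF : map_mx phi (e (v, u)) = e (v, u) *m perm_mx (v^-1 * p.1 * v)%g.
    rewrite /e /= map_mxM frob_frame map_mxM map_perm_mx map_diag_mx -!mulmxA; congr (_ *m _).
    rewrite -!perm_mxM !mulgA mulgV mul1g perm_mxM !mulmxA perm_mx_diag.
    congr (diag_mx _ *m _ *m _); apply/rowP => i; rewrite !mxE; exact: u_fix.
  have [h hE] := frame_surj eU eF.
  exists ((v^-1 * p.1 * v)%g, h); last by rewrite -hE.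
  rewrite inE; apply/asboolP; rewrite /torus_of -hE /e conj_setM ?frame_unit ?monomial_unit //.
  by rewrite conj_monomial.
move=> p'; rewrite inE => /asboolP pp'.
have [s [v [s0 p'E]]] := conj_diag_eq (frame_unit p) (frame_unit p') (esym pp').
have := frob_frame p'; rewrite p'E map_mxM frob_frame map_mxM map_perm_mx map_diag_mx -!mulmxA.
move=> /(can_inj (mulKmx (frame_unit p))); rewrite mulmxA perm_mx_diag -mulmxA -!perm_mxM.
move=> /monomial_inj[|sE _]; first by move=> i; rewrite !mxE fmorph_eq0.
have /(fixed_vecP iota phiE)[u uE] : perm_fixed phi p.1 s.
  by move=> i; move/rowP/(_ i): sE; rewrite !mxE.
exists (v, u); last by rewrite /e /= -uE.
rewrite !inE /= -uE; apply/eqP/setP => i; rewrite !inE; exact: s0.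
Qed.

(** Two matrices [g] giving the same torus differ by a monomial matrix, which
    conjugates one permutation into the other. *)
Lemma torus_type_odd p lambda : torus_type #|Fq| (torus_of p) lambda ->
  exists2 w : 'S_n, lambda = cycle_type w & odd_perm w = odd_perm p.1.
Proof.
move=> [g [w [gU gT [_ /diag_torusP[t -> t0] gF] ->]]]; exists w => //.
have gFE : map_mx phi g = g *m (perm_mx w *m diag_mx t).
  by rewrite -gF frobE mulKVmx.
have [s [v [s0 pE]]] := conj_diag_eq gU (frame_unit p) (esym gT).
have := frob_frame p; rewrite pE !map_mxM gFE map_perm_mx map_diag_mx -!mulmxA.
move=> /(can_inj (mulKmx gU)).
rewrite (mulmxA (diag_mx t)) mulmx_diag (mulmxA (perm_mx w)) perm_mx_diag -mulmxA -!perm_mxM.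
move=> /monomial_inj[|_ wv]; first by move=> i; rewrite !mxE mulf_neq0 ?fmorph_eq0.
by have := congr1 (@odd_perm _) wv; rewrite !odd_permM addbC => /addbI.
Qed.

Lemma torus_of_type p : torus_type #|Fq| (torus_of p) (cycle_type p.1).
Proof.
exists (frame p), p.1; split=> //; first exact: frame_unit.
exists 1%:M; last by rewrite frobE frob_frame mulmx1 mulKmx // frame_unit.
by rewrite -diag_const_mx; apply/mem_diag_torus => i; rewrite mxE oner_neq0.
Qed.

Lemma odd_size_cycle_type w : odd (size (cycle_type w)) = odd n (+) odd_perm w.
Proof.
by rewrite size_sort size_map -cardE /odd_perm card_ord addbA addbb addFb.
Qed.

Lemma irreducible_factors_odd p r : irreducible_factors #|Fq| (torus_of p) r ->
  odd r = odd n (+) odd_perm p.1.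
Proof. by move=> [_ /torus_type_odd[w -> <-] ->]; exact: odd_size_cycle_type. Qed.

Lemma torus_of_irreducible_factors p :
  irreducible_factors #|Fq| (torus_of p) (size (cycle_type p.1)).
Proof. by exists (cycle_type p.1) => //; exact: torus_of_type. Qed.

Lemma torus_of_odd p p' : torus_of p = torus_of p' -> odd_perm p.1 = odd_perm p'.1.
Proof.
move=> pp'; have := torus_of_irreducible_factors p.
rewrite pp' => /irreducible_factors_odd; rewrite odd_size_cycle_type.
exact: addbI.
Qed.

End StableTori.

(** * The signed count of tori *)

Section Counting.
Variables (Fq : finFieldType) (K : closedFieldType) (iota : {rmorphism Fq -> K}).
Hypothesis hK : algebraic_closure iota.
Variables (phi : {rmorphism K -> K}) (phiE : forall x, phi x = x ^+ #|Fq|).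
Variable m : nat.

Local Notation n := m.+1.
Local Notation P := ('S_n * {'GL_n[Fq]})%type.
Local Notation nb := (nb_fixed iota phiE).
Local Notation torus_of := (@torus_of Fq K iota phi phiE m).

(** A choice function on the fibres of [torus_of], so that tori can be counted inside
    a finite type. *)
Definition representative (p : P) : P :=
  odflt p [pick p' : P | `[< torus_of p' = torus_of p >]].

Lemma torus_of_representative p : torus_of (representative p) = torus_of p.
Proof. by rewrite /representative; case: pickP => [p' /asboolP|]. Qed.

Lemma representativeE p p' :
  (representative p == representative p') = `[< torus_of p = torus_of p' >].
Proof.
apply/eqP/asboolP => [pp'|pp'].
  by rewrite -(torus_of_representative p) pp' torus_of_representative.
by rewrite /representative pp'; case: pickP => // /(_ p')/asboolP[].
Qed.

Definition representatives (b : bool) : {set P} :=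
  [set p | (representative p == p) && (odd_perm p.1 == b)]%SET.

Lemma card_stable_tori (b : bool) (Q : nat -> Prop) :
  (forall r, Q r <-> odd r = odd n (+) b) ->
  [set T | F_stable_maximal_tori K #|Fq| n T /\ exists2 r, irreducible_factors #|Fq| T r & Q r]
    #= `I_#|representatives b|.
Proof.
move=> QE; have -> : [set T | F_stable_maximal_tori K #|Fq| n T /\
    exists2 r, irreducible_factors #|Fq| T r & Q r] =
  [set T | exists2 p, p \in representatives b & T = torus_of p].
  apply/seteqP; split=> [T [/(torus_of_surj hK phiE)[p ->] [r]]|_ [p pb ->]].
    move=> /irreducible_factors_odd rE /QE; rewrite rE => /addbI pb.
    exists (representative p); last by rewrite torus_of_representative.
    rewrite inE representativeE; apply/andP; split.
      by apply/asboolP; exact: torus_of_representative.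
    by rewrite (torus_of_odd (torus_of_representative p)) pb.
  split; first exact: torus_of_stable.
  exists (size (cycle_type p.1)); first exact: torus_of_irreducible_factors.
  by move: pb; rewrite QE odd_size_cycle_type inE => /andP[_ /eqP->].
apply: card_image_finset => p p'; rewrite !inE => /andP[/eqP <- _] /andP[/eqP <- _].
by rewrite !torus_of_representative => pp'; apply/eqP; rewrite representativeE; apply/asboolP.
Qed.

(** By [card_torus_of] the summand at [p] is [n!] times a sign, divided by the size
    of the fibre of [p]; summing over each fibre leaves [n!] times the sign. *)
Lemma sum_representatives :
  \sum_(p : P) (-1) ^+ p.1 / (nb p.1 [set: 'I_n]%SET)%:R =
  n`!%:R * (#|representatives false|%:R - #|representatives true|%:R) :> rat.
Proof.
rewrite (partition_big representative (fun p => representative p == p)) /=; last first.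
  by move=> p _; rewrite representativeE; apply/asboolP; exact: torus_of_representative.
rewrite (eq_bigr (fun p : P => n`!%:R * (-1) ^+ p.1)) => [|p /eqP pE]; last first.
  have fiberE p' : (representative p' == p) = `[< torus_of p' = torus_of p >].
    by rewrite -{1}pE representativeE.
  (* The fibre has [c] elements, so [1 / nb] is [n! / c] at each of them. *)
  pose c := #|[set p' : P | `[< torus_of p' = torus_of p >]]%SET|.
  have c_neq0 : c%:R != 0 :> rat.
    rewrite Num.Theory.pnatr_eq0 -lt0n; apply/card_gt0P; exists p.
    by rewrite inE; apply/asboolP.
  rewrite (eq_bigr (fun=> n`!%:R * (-1) ^+ p.1 / c%:R)) => [|p'].
    rewrite sumr_const (_ : #|_| = c); last first.
      by apply: eq_card => p'; rewrite inE -fiberE unfold_in.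
    by rewrite -[LHS]mulr_natr divfK.
  rewrite fiberE => /asboolP pp'.
  rewrite -(torus_of_odd pp') /c -pp' card_torus_of natrM.
  rewrite invfM mulrACA divff ?mul1r //.
  by rewrite Num.Theory.pnatr_eq0 -lt0n fact_gt0.
rewrite -mulr_sumr; congr (_ * _).
rewrite (bigID (fun p : P => odd_perm p.1 == false)) /=; congr (_ + _).
  rewrite (eq_bigr (fun=> 1)) => [|p /andP[_ /eqP->]]; last by rewrite expr0.
  by rewrite sumr_const; congr (_ *+ _); apply: eq_card => p; rewrite !inE.
rewrite (eq_bigr (fun=> - 1)) => [|p /andP[_]]; last by case: odd_perm.
rewrite sumr_const mulNrn; congr (- (_ *+ _)); apply: eq_card => p; rewrite !inE.
by rewrite unfold_in; case: odd_perm.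
Qed.
End Counting.

(** * The difference of the two counts *)

Theorem theorem3p7 (q n : nat) (Fq : finFieldType) (K : closedFieldType)
    (iota : {rmorphism Fq -> K}) (hq : #|Fq| = q)
    (hK : algebraic_closure iota) (hn : (1 <= n)%N) :
  exists a b : nat,
    [/\ [set T | F_stable_maximal_tori K q n T /\
           exists2 r, irreducible_factors q T r & (r = n %[mod 2])%N] #= `I_a,
        [set T | F_stable_maximal_tori K q n T /\
           exists2 r, irreducible_factors q T r & (r <> n %[mod 2])%N] #= `I_b &
        a%:Z - b%:Z = (q ^ ((n ^ 2 - n) %/ 2))%N%:Z].
Proof.
case: n hn => // m _; rewrite -{q}hq.
have [phi phiE] := frobenius_rmorphism iota.
exists #|representatives iota phiE m false|, #|representatives iota phiE m true|.
have mod2E r : (r = m.+1 %[mod 2])%N <-> odd r = odd m.+1.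
  by rewrite !modn2; split=> [|->] //; do 2!case: odd.
split.
- by apply: (card_stable_tori hK) => r; rewrite addbF.
- apply: (card_stable_tori hK) => r; rewrite addbT mod2E.
  by do 2!case: odd; split.
apply: (@intr_inj rat); rewrite rmorphB /= -!pmulrn.
have fact_neq0 : (m.+1)`!%:R != 0 :> rat by rewrite Num.Theory.pnatr_eq0 -lt0n fact_gt0.
apply: (mulfI fact_neq0); rewrite -(sum_representatives iota phiE).
rewrite -(pair_bigA _ (fun (w : 'S_m.+1) (h : {'GL_m.+1[Fq]}) =>
  (-1) ^+ w / (nb_fixed iota phiE w [set: 'I_m.+1]%SET)%:R)) /=.
transitivity (#|'GL_m.+1[Fq]%g|%:R * signed_sum iota phiE m.+1).
  by rewrite mulr_sumr; apply: eq_bigr => w _; rewrite sumr_const cardsT mulr_natl.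
rewrite card_GL // natrM.
rewrite mulrAC -mulrA (signed_sumE iota phiE) mulrC; congr (_ * (#|Fq| ^ _)%N%:R).
by rewrite bin2 -divn2 -mulnn -[X in (_ - X)%N]muln1 -mulnBr subn1.
Qed.
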